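(* Let $k$ be a field. Let $A$ and $B$ be a pair of symmetrically separably equivalent $k$-algebras, let $C$ and $D$ be a second pair of symmetrically separably equivalent $k$-algebras, and let $\mathcal{E}$ be a small $k$-category. Then the following pairs of functor categories are symmetrically separably equivalent: (a) $\operatorname{Fun}(\operatorname{mod} A, \operatorname{mod} C)$ and $\operatorname{Fun}(\operatorname{mod} B, \operatorname{mod} D)$; (b) $\operatorname{Fun}(\operatorname{mod} A, \mathcal{E})$ and $\operatorname{Fun}(\operatorname{mod} B, \mathcal{E})$; (c) $\operatorname{Fun}(\mathcal{E}, \operatorname{mod} A)$ and $\operatorname{Fun}(\mathcal{E}, \operatorname{mod} B)$.
   Context: Algebras are finite dimensional, associative and unital over $k$; $\operatorname{mod} A$ is the category of finitely generated right $A$-modules; $k$ acts centrally on all bimodules. A $k$-category is a category enriched in $k$-vector spaces; functors between $k$-categories are $k$-linear, and $\operatorname{Fun}(\mathcal{A},\mathcal{C})$ denotes the category of ($k$-linear) functors $\mathcal{A}\to\mathcal{C}$ with natural transformations as morphisms. Symmetrical separable equivalence of algebras: $A$ and $B$ are symmetrically separably equivalent if there are bimodules ${}_AM_B$ and ${}_BN_A$, each finitely generated and projective as a left module and as a right module, such that $A$ is a direct summand of $M\otimes_B N$ as an $A$-$A$-bimodule, $B$ is a direct summand of $N\otimes_A M$ as a $B$-$B$-bimodule, and the functor $-\otimes_A M:\operatorname{mod} A\to\operatorname{mod} B$ is both left and right adjoint to $-\otimes_B N:\operatorname{mod} B\to\operatorname{mod} A$. Symmetrical separable equivalence of categories: $k$-categories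 $\mathcal{A}$ and $\mathcal{B}$ are symmetrically separably equivalent if there are ($k$-linear) functors $F:\mathcal{A}\to\mathcal{B}$ and $G:\mathcal{B}\to\mathcal{A}$ such that $(F,G)$ and $(G,F)$ are both adjoint pairs, the identity functor of $\mathcal{A}$ is a summand of $GF$, and the identity functor of $\mathcal{B}$ is a summand of $FG$. Here $\mathrm{Id}$ is a summand of a functor $H$ if there are natural transformations $\mathrm{Id}\Rightarrow H\Rightarrow\mathrm{Id}$ with composite the identity. *)

(* Defs.v *)
From HB Require Import structures.
From mathcomp Require Import all_boot all_algebra.
From mathcomp Require Import generic_quotient ring_quotient boolp.
From mathcomp.multinomials Require Import freeg.

Set Implicit Arguments.
Unset Strict Implicit.
Unset Printing Implicit Defensive.

Import GRing.Theory.
Local Open Scope ring_scope.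

Record kspace (k : fieldType) (T : Type) := KSpace {
  kzero : T;
  kadd : T -> T -> T;
  kopp : T -> T;
  kscale : k -> T -> T;
  kaddA : associative kadd;
  kaddC : commutative kadd;
  kadd0 : left_id kzero kadd;
  kaddN : left_inverse kzero kopp kadd;
  kscaleA : forall a b x, kscale a (kscale b x) = kscale (a * b) x;
  kscale1 : forall x, kscale 1 x = x;
  kscaleDr : forall a x y, kscale a (kadd x y) = kadd (kscale a x) (kscale a y);
  kscaleDl : forall a b x, kscale (a + b) x = kadd (kscale a x) (kscale b x)
}.

(* The vector space structure of the hom-sets is a kspace and not an lmodType:
   the natural transformations between two functors on a category of modules
   do not live in the universe of the carriers of lmodType. *)
Record kcat (k : fieldType) := KCat {
  ob :> Type;
  khom : ob -> ob -> Type;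
  hom_space : forall x y, kspace k (khom x y);
  kidm : forall x, khom x x;
  kcomp : forall x y z, khom y z -> khom x y -> khom x z;
  comp1m : forall x y (f : khom x y), kcomp (kidm y) f = f;
  compm1 : forall x y (f : khom x y), kcomp f (kidm x) = f;
  compA : forall w x y z (f : khom y z) (g : khom x y) (h : khom w x),
    kcomp f (kcomp g h) = kcomp (kcomp f g) h;
  compDl : forall x y z (f f' : khom y z) (g : khom x y),
    kcomp (kadd (hom_space y z) f f') g
      = kadd (hom_space x z) (kcomp f g) (kcomp f' g);
  compDr : forall x y z (f : khom y z) (g g' : khom x y),
    kcomp f (kadd (hom_space x y) g g')
      = kadd (hom_space x z) (kcomp f g) (kcomp f g');
  compZl : forall x y z a (f : khom y z) (g : khom x y),
    kcomp (kscale (hom_space y z) a f) g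
      = kscale (hom_space x z) a (kcomp f g);
  compZr : forall x y z a (f : khom y z) (g : khom x y),
    kcomp f (kscale (hom_space x y) a g)
      = kscale (hom_space x z) a (kcomp f g)
}.

Arguments khom {_ _}.
Arguments hom_space {_ _}.
Arguments kidm {_ _}.
Arguments kcomp {_ _ x y z}.

Record kfunctor (k : fieldType) (C D : kcat k) := KFunctor {
  fob :> C -> D;
  fmap : forall x y, khom x y -> khom (fob x) (fob y);
  fmap1 : forall x, fmap (kidm x) = kidm (fob x);
  fmap_comp : forall x y z (f : khom y z) (g : khom x y),
    fmap (kcomp f g) = kcomp (fmap f) (fmap g);
  fmapD : forall x y (f g : khom x y),
    fmap (kadd (hom_space x y) f g)
      = kadd (hom_space (fob x) (fob y)) (fmap f) (fmap g);
  fmapZ : forall x y a (f : khom x y),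
    fmap (kscale (hom_space x y) a f)
      = kscale (hom_space (fob x) (fob y)) a (fmap f)
}.

Arguments fmap {_ _ _} _ {x y}.

Definition kfunctor_id (k : fieldType) (C : kcat k) : kfunctor C C :=
  @KFunctor k C C id (fun _ _ f => f) (fun _ => erefl)
    (fun _ _ _ _ _ => erefl) (fun _ _ _ _ => erefl) (fun _ _ _ _ => erefl).

Definition kfunctor_comp (k : fieldType) (C D E : kcat k)
  (G : kfunctor D E) (F : kfunctor C D) : kfunctor C E.
Proof.
refine (@KFunctor k C E (fun x => G (F x)) (fun x y f => fmap G (fmap F f))
  _ _ _ _).
- by move=> x; rewrite !fmap1.
- by move=> x y z f g; rewrite !fmap_comp.
- by move=> x y f g; rewrite !fmapD.
- by move=> x y a f; rewrite !fmapZ.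
Defined.

Record nattrans (k : fieldType) (C D : kcat k) (F G : kfunctor C D) :=
  NatTrans {
    ncomp :> forall x, khom (F x) (G x);
    naturality : forall x y (f : khom x y),
      kcomp (ncomp y) (fmap F f) = kcomp (fmap G f) (ncomp x)
  }.

Section FunctorCategory.
Variables (k : fieldType) (C D : kcat k).
Implicit Types F G H K : kfunctor C D.

Lemma nattrans_ext F G (s t : nattrans F G) : (forall x, s x = t x) -> s = t.
Proof.
case: s t => [s Hs] [t Ht] /= st.
have {}st : s = t by apply: functional_extensionality_dep.
by subst t; congr NatTrans; exact: Prop_irrelevance.
Qed.

Lemma comp_zerol x y z (g : khom x y) :
  kcomp (kzero (hom_space y z)) g = kzero (@hom_space k D x z).
Proof.
set K := hom_space x z; set u := kcomp _ g.
have uu : kadd K u u = u by rewrite -compDl kadd0.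
by rewrite -[LHS](kadd0 K) -[X in kadd K X](kaddN K u) -kaddA uu kaddN.
Qed.

Lemma comp_zeror x y z (f : khom y z) :
  kcomp f (kzero (hom_space x y)) = kzero (@hom_space k D x z).
Proof.
set K := hom_space x z; set u := kcomp f _.
have uu : kadd K u u = u by rewrite -compDr kadd0.
by rewrite -[LHS](kadd0 K) -[X in kadd K X](kaddN K u) -kaddA uu kaddN.
Qed.

Lemma kopp_unique (T : Type) (K : kspace k T) u v :
  kadd K u v = kzero K -> u = kopp K v.
Proof.
move=> uv; rewrite -[RHS](kadd0 K) -uv -kaddA [kadd K v _]kaddC kaddN.
by rewrite kaddC kadd0.
Qed.

Lemma comp_oppl x y z (f : khom y z) (g : khom x y) :
  kcomp (kopp (hom_space y z) f) g = kopp (@hom_space k D x z) (kcomp f g).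
Proof. by apply: kopp_unique; rewrite -compDl kaddN comp_zerol. Qed.

Lemma comp_oppr x y z (f : khom y z) (g : khom x y) :
  kcomp f (kopp (hom_space x y) g) = kopp (@hom_space k D x z) (kcomp f g).
Proof. by apply: kopp_unique; rewrite -compDr kaddN comp_zeror. Qed.

Definition nzero F G : nattrans F G.
Proof.
exists (fun x => kzero (hom_space (F x) (G x))) => x y f.
by rewrite comp_zerol comp_zeror.
Defined.

Definition nadd F G (s t : nattrans F G) : nattrans F G.
Proof.
exists (fun x => kadd (hom_space (F x) (G x)) (s x) (t x)) => x y f.
by rewrite compDl compDr !naturality.
Defined.

Definition nopp F G (s : nattrans F G) : nattrans F G.
Proof.
exists (fun x => kopp (hom_space (F x) (G x)) (s x)) => x y f.
by rewrite comp_oppl comp_oppr naturality.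
Defined.

Definition nscale F G (a : k) (s : nattrans F G) : nattrans F G.
Proof.
exists (fun x => kscale (hom_space (F x) (G x)) a (s x)) => x y f.
by rewrite compZl compZr naturality.
Defined.

Definition nspace F G : kspace k (nattrans F G).
Proof.
refine (@KSpace k _ (nzero F G) (@nadd F G) (@nopp F G) (@nscale F G)
  _ _ _ _ _ _ _ _).
- by move=> r s t; apply: nattrans_ext => x /=; rewrite kaddA.
- by move=> s t; apply: nattrans_ext => x /=; rewrite kaddC.
- by move=> s; apply: nattrans_ext => x /=; rewrite kadd0.
- by move=> s; apply: nattrans_ext => x /=; rewrite kaddN.
- by move=> a b s; apply: nattrans_ext => x /=; rewrite kscaleA.
- by move=> s; apply: nattrans_ext => x /=; rewrite kscale1.
- by move=> a s t; apply: nattrans_ext => x /=; rewrite kscaleDr.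
- by move=> a b s; apply: nattrans_ext => x /=; rewrite kscaleDl.
Defined.

Definition nid F : nattrans F F.
Proof. by exists (fun x => kidm (F x)) => x y f; rewrite comp1m compm1. Defined.

Definition nvcomp F G H (t : nattrans G H) (s : nattrans F G) : nattrans F H.
Proof.
exists (fun x => kcomp (t x) (s x)) => x y f.
by rewrite -compA naturality !compA naturality.
Defined.

Definition Fun : kcat k.
Proof.
refine (@KCat k (kfunctor C D) (@nattrans k C D) nspace nid nvcomp
  _ _ _ _ _ _ _).
- by move=> F G s; apply: nattrans_ext => x /=; rewrite comp1m.
- by move=> F G s; apply: nattrans_ext => x /=; rewrite compm1.
- by move=> F G H K r s t; apply: nattrans_ext => x /=; rewrite compA.
- by move=> F G H s s' t; apply: nattrans_ext => x /=; rewrite compDl.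
- by move=> F G H s t t'; apply: nattrans_ext => x /=; rewrite compDr.
- by move=> F G H a s t; apply: nattrans_ext => x /=; rewrite compZl.
- by move=> F G H a s t; apply: nattrans_ext => x /=; rewrite compZr.
Defined.

End FunctorCategory.

(* F is left adjoint to G. *)
Definition adjoint_pair (k : fieldType) (C D : kcat k)
    (F : kfunctor C D) (G : kfunctor D C) : Prop :=
  exists (eta : nattrans (kfunctor_id C) (kfunctor_comp G F))
         (eps : nattrans (kfunctor_comp F G) (kfunctor_id D)),
    (forall x : C, kcomp (eps (F x)) (fmap F (eta x)) = kidm (F x)) /\
    (forall y : D, kcomp (fmap G (eps y)) (eta (G y)) = kidm (G y)).

Definition id_summand (k : fieldType) (C : kcat k) (H : kfunctor C C) : Prop :=
  exists (i : nattrans (kfunctor_id C) H) (p : nattrans H (kfunctor_id C)),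
    nvcomp p i = nid (kfunctor_id C).

Definition cat_symm_sep_equiv (k : fieldType) (C D : kcat k) : Prop :=
  exists (F : kfunctor C D) (G : kfunctor D C),
    [/\ adjoint_pair F G, adjoint_pair G F,
        id_summand (kfunctor_comp G F) & id_summand (kfunctor_comp F G)].

(* A finite dimensional k-algebra, as a ring with a central ring morphism
   from k. Unlike falgType, this allows the zero algebra. *)
Record fdAlg (k : fieldType) := FdAlg {
  fdalg_ring :> pzRingType;
  scal : {rmorphism k -> fdalg_ring};
  scalC : forall (c : k) (a : fdalg_ring), scal c * a = a * scal c;
  fdalg_findim : exists n (e : 'I_n -> fdalg_ring), forall a,
    exists c : 'I_n -> k, a = \sum_(i < n) scal (c i) * e i
}.

Arguments scal {_}.

(* A right A-module is a left module over the converse ring A^c, and x . a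
   is written (a : A^c) *: x. *)

Definition fin_gen (R : pzRingType) (V : lmodType R) : Prop :=
  exists n (e : 'I_n -> V), forall v,
    exists c : 'I_n -> R, v = \sum_(i < n) c i *: e i.

Lemma fin_gen_finType (R : pzRingType) (V : lmodType R) (I : finType)
    (e : I -> V) :
  (forall v, exists c : I -> R, v = \sum_i c i *: e i) -> fin_gen V.
Proof.
move=> He; exists #|I|, (e \o enum_val) => v; have [c ->] := He v.
exists (c \o enum_val).
by rewrite (reindex (enum_val (A := I))) //; apply: onW_bij; exact: enum_val_bij.
Qed.

Definition projective (R : pzRingType) (P : lmodType R) : Prop :=
  forall (X Y : lmodType R) (g : {linear X -> Y}) (f : {linear P -> Y}),
    (forall y, exists x, g x = y) ->
    exists h : {linear P -> X}, forall p, g (h p) = f p.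

Lemma linear_ext (R : pzRingType) (X Y : lmodType R) (f g : {linear X -> Y}) :
  f =1 g -> f = g.
Proof.
case: f => f [[Hf0] [Hf1]]; case: g => g [[Hg0] [Hg1]] /= fg.
have {}fg : f = g by apply: functional_extensionality_dep.
subst g.
by rewrite (Prop_irrelevance Hf0 Hg0) (Prop_irrelevance Hf1 Hg1).
Qed.

Section ModCategory.
Variables (k : fieldType) (A : fdAlg k).

Record fgmod := FgMod {
  fgmod_car :> lmodType A^c;
  fgmod_fg : fin_gen fgmod_car
}.

Section Hom.
Variables (X Y : lmodType A^c).

Definition rscale (c : k) (f : X -> Y) : X -> Y :=
  fun x => (scal A c : A^c) *: f x.

Fact rscale_linear c (f : {linear X -> Y}) : linear (rscale c f).
Proof.
move=> a x y; rewrite /rscale linearP scalerDr !scalerA; congr (_ *: _ + _).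
exact/esym/scalC.
Qed.
HB.instance Definition _ c (f : {linear X -> Y}) :=
  GRing.isLinear.Build A^c X Y *:%R (rscale c f) (rscale_linear c f).

Definition lin_space : kspace k {linear X -> Y}.
Proof.
refine (@KSpace k {linear X -> Y} (\0 : {linear X -> Y})
  (fun f g => (f \+ g : {linear X -> Y})) (fun f => (\- f : {linear X -> Y}))
  (fun c f => (rscale c f : {linear X -> Y})) _ _ _ _ _ _ _ _).
- by move=> f g h; apply: linear_ext => x /=; rewrite addrA.
- by move=> f g; apply: linear_ext => x /=; rewrite addrC.
- by move=> f; apply: linear_ext => x /=; rewrite add0r.
- by move=> f; apply: linear_ext => x /=; rewrite addNr.
- move=> a b f; apply: linear_ext => x /=; rewrite /rscale scalerA rmorphM.
  by congr (_ *: _); exact: scalC.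
- by move=> f; apply: linear_ext => x /=; rewrite /rscale rmorph1 scale1r.
- by move=> a f g; apply: linear_ext => x /=; rewrite /rscale scalerDr.
- by move=> a b f; apply: linear_ext => x /=; rewrite /rscale rmorphD scalerDl.
Defined.

End Hom.

Definition modcat : kcat k.
Proof.
refine (@KCat k fgmod (fun X Y => {linear X -> Y}) (fun X Y => lin_space X Y)
  (fun X => (idfun : {linear X -> X}))
  (fun X Y Z f g => (f \o g : {linear X -> Z})) _ _ _ _ _ _ _).
- by move=> X Y f; apply: linear_ext.
- by move=> X Y f; apply: linear_ext.
- by move=> W X Y Z f g h; apply: linear_ext.
- by move=> X Y Z f f' g; apply: linear_ext.
- by move=> X Y Z f g g'; apply: linear_ext => x /=; rewrite linearD.
- by move=> X Y Z a f g; apply: linear_ext.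
- by move=> X Y Z a f g; apply: linear_ext => x /=; rewrite /rscale linearZ.
Defined.

End ModCategory.

Section Tensor.
Variables (R : pzRingType) (X : lmodType R^c) (Y : lmodType R).

Definition tensor_free := {freeg (X * Y)%type / int}.

Definition pure (x : X) (y : Y) : tensor_free := << (x, y) >>.

(* The subgroup by which the free abelian group on X * Y is divided. *)
Inductive tensor_rel : tensor_free -> Prop :=
| tensor_rel0 : tensor_rel 0
| tensor_relB u v : tensor_rel u -> tensor_rel v -> tensor_rel (u - v)
| tensor_relDl x x' y : tensor_rel (pure (x + x') y - (pure x y + pure x' y))
| tensor_relDr x y y' : tensor_rel (pure x (y + y') - (pure x y + pure x y'))
| tensor_relA x (a : R) y :
    tensor_rel (pure ((a : R^c) *: x) y - pure x (a *: y)).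

Definition tensor_null : {pred tensor_free} := [pred u | `[< tensor_rel u >]].

Lemma tensor_nullP u : reflect (tensor_rel u) (u \in tensor_null).
Proof. exact: asboolP. Qed.

Fact tensor_null_closed : zmod_closed tensor_null.
Proof.
split=> [|u v /tensor_nullP Hu /tensor_nullP Hv]; apply/tensor_nullP.
  exact: tensor_rel0.
exact: tensor_relB.
Qed.

HB.instance Definition _ :=
  GRing.isZmodClosed.Build tensor_free tensor_null tensor_null_closed.

Definition tensor : zmodType := Quotient.quot tensor_null.

Local Open Scope quotient_scope.

Definition tens_pi (u : tensor_free) : tensor :=
  \pi_(Quotient.quot tensor_null) u.

Definition tens (x : X) (y : Y) : tensor := tens_pi (pure x y).

Lemma tens_piB u v : tens_pi (u - v) = tens_pi u - tens_pi v.
Proof. by rewrite /tens_pi !piE. Qed.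

Lemma tens_piD u v : tens_pi (u + v) = tens_pi u + tens_pi v.
Proof. by rewrite /tens_pi !piE. Qed.

Lemma tens_pi_eq u v : tensor_rel (u - v) <-> tens_pi u = tens_pi v.
Proof.
rewrite /tens_pi; split=> [H|/eqP H].
  by apply/eqP; rewrite -Quotient.idealrBE; apply/tensor_nullP.
by apply/tensor_nullP; rewrite Quotient.idealrBE.
Qed.

Definition tens_repr (t : tensor) : tensor_free :=
  repr (t : Quotient.quot tensor_null).

Lemma tens_reprK t : tens_pi (tens_repr t) = t.
Proof. exact: reprK. Qed.

Lemma tensDl x x' y : tens (x + x') y = tens x y + tens x' y.
Proof. by rewrite -tens_piD; apply/tens_pi_eq; exact: tensor_relDl. Qed.

Lemma tensDr x y y' : tens x (y + y') = tens x y + tens x y'.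
Proof. by rewrite -tens_piD; apply/tens_pi_eq; exact: tensor_relDr. Qed.

Lemma tensA x (a : R) y : tens ((a : R^c) *: x) y = tens x (a *: y).
Proof. by apply/tens_pi_eq; exact: tensor_relA. Qed.

Lemma tens0l y : tens 0 y = 0.
Proof. by apply: (addrI (tens 0 y)); rewrite -tensDl !addr0. Qed.

Lemma tens0r x : tens x 0 = 0.
Proof. by apply: (addrI (tens x 0)); rewrite -tensDr !addr0. Qed.

Lemma tens_suml n (e : 'I_n -> X) y :
  tens (\sum_i e i) y = \sum_i tens (e i) y.
Proof.
exact: (big_morph (tens^~ y) (fun x x' => tensDl x x' y) (tens0l y)).
Qed.

Lemma tens_sumr x n (e : 'I_n -> Y) :
  tens x (\sum_i e i) = \sum_i tens x (e i).
Proof. exact: (big_morph (tens x) (tensDr x) (tens0r x)). Qed.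

Section Lift.
Variables (Z : zmodType) (f : X -> Y -> Z).

Definition tens_lift (t : tensor) : Z :=
  fglift (M := zmodule Z) (fun p : X * Y => f p.1 p.2) (tens_repr t).

Hypothesis fDl : forall x x' y, f (x + x') y = f x y + f x' y.
Hypothesis fDr : forall x y y', f x (y + y') = f x y + f x y'.
Hypothesis fA : forall x (a : R) y, f ((a : R^c) *: x) y = f x (a *: y).

Let F : tensor_free -> zmodule Z := 
  fglift (M := zmodule Z) (fun p : X * Y => f p.1 p.2).

Let F_pure x y : F (pure x y) = f x y.
Proof. by rewrite /F /pure liftU scale1r. Qed.

Let FB : zmod_morphism F. Proof. exact: lift_is_additive. Qed.

Let F_rel u : tensor_rel u -> F u = 0.
Proof.
pose G : {additive tensor_free -> zmodule Z} :=
  HB.pack F (GRing.isZmodMorphism.Build _ _ F FB).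
rewrite -[F]/(G : _ -> _).
elim=> [|{}u v _ Hu _ Hv|x x' y|x y y'|x a y].
- exact: raddf0.
- by rewrite raddfB Hu Hv subrr.
- by rewrite raddfB raddfD /= !F_pure fDl subrr.
- by rewrite raddfB raddfD /= !F_pure fDr subrr.
- by rewrite raddfB /= !F_pure fA subrr.
Qed.

Let F_pi u : tens_lift (tens_pi u) = F u.
Proof.
apply/eqP; rewrite -subr_eq0 -[_ - _]FB; apply/eqP/F_rel/tens_pi_eq.
exact: tens_reprK.
Qed.

Lemma tens_liftE x y : tens_lift (tens x y) = f x y.
Proof. by rewrite F_pi F_pure. Qed.

Lemma tens_liftB : {morph tens_lift : t u / t - u}.
Proof.
move=> t u; rewrite -[t]tens_reprK -[u]tens_reprK -tens_piB !F_pi.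
exact: FB.
Qed.

End Lift.

Lemma tens_ind (P : tensor -> Prop) :
  P 0 -> (forall t u, P t -> P u -> P (t - u)) ->
  (forall x y, P (tens x y)) -> forall t, P t.
Proof.
move=> P0 PB Pxy t; rewrite -[t]tens_reprK -[tens_repr t]freeg_sumE.
have PN u : P u -> P (- u) by move=> Pu; rewrite -sub0r; exact: PB.
have PD u v : P u -> P v -> P (u + v).
  by move=> Pu Pv; rewrite -[v]opprK; apply: PB => //; exact: PN.
pose Q : {additive tensor_free -> tensor} :=
  HB.pack tens_pi (GRing.isZmodMorphism.Build _ _ tens_pi tens_piB).
rewrite -[tens_pi]/(Q : _ -> _) raddf_sum; apply: big_ind => // -[x y] _.
rewrite -[coeff _ _]intz -freegU_mulz raddfMz.
have Pn n : P (Q (pure x y) *+ n).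
  elim: n => [|n IHn]; first by rewrite mulr0n.
  by rewrite mulrS; apply: PD => //; exact: Pxy.
case: (coeff _ _) => n; first exact: Pn.
by rewrite NegzE mulrNz; apply/PN/Pn.
Qed.

Lemma tens_ext (Z : zmodType) (g h : {additive tensor -> Z}) :
  (forall x y, g (tens x y) = h (tens x y)) -> g =1 h.
Proof.
move=> gh; apply: tens_ind => // [|t u gt gu]; first by rewrite !raddf0.
by rewrite !raddfB gt gu.
Qed.

End Tensor.

Section TensorMap.
Variables (R : pzRingType) (X X' : lmodType R^c) (Y Y' : lmodType R).

Definition tens_map (f : {linear X -> X'}) (g : {linear Y -> Y'}) :
  tensor X Y -> tensor X' Y' := tens_lift (fun x y => tens (f x) (g y)).

Section Theory.
Variables (f : {linear X -> X'}) (g : {linear Y -> Y'}).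

Let mapDl x x' y :
  tens (f (x + x')) (g y) = tens (f x) (g y) + tens (f x') (g y).
Proof. by rewrite linearD tensDl. Qed.

Let mapDr x y y' :
  tens (f x) (g (y + y')) = tens (f x) (g y) + tens (f x) (g y').
Proof. by rewrite linearD tensDr. Qed.

Let mapA x (a : R) y :
  tens (f ((a : R^c) *: x)) (g y) = tens (f x) (g (a *: y)).
Proof. by rewrite !linearZ /= tensA. Qed.

Lemma tens_mapE x y : tens_map f g (tens x y) = tens (f x) (g y).
Proof. exact: (tens_liftE mapDl mapDr mapA). Qed.

Fact tens_map_zmod_morphism : zmod_morphism (tens_map f g).
Proof. exact: (tens_liftB mapDl mapDr mapA). Qed.

HB.instance Definition _ :=
  GRing.isZmodMorphism.Build _ _ (tens_map f g) tens_map_zmod_morphism.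
End Theory.

End TensorMap.

(* The last axiom says that k acts centrally. *)
Record bimod (k : fieldType) (A B : fdAlg k) := Bimod {
  bimodl :> lmodType A;
  ract : bimodl -> B -> bimodl;
  ractDl : forall m m' b, ract (m + m') b = ract m b + ract m' b;
  ractDr : forall m b b', ract m (b + b') = ract m b + ract m b';
  ractM : forall m b b', ract m (b * b') = ract (ract m b) b';
  ract1 : forall m, ract m 1 = m;
  ractZ : forall (a : A) m b, ract (a *: m) b = a *: ract m b;
  ract_scal : forall (c : k) m, ract m (scal B c) = scal A c *: m
}.

Section BimodRight.
Variables (k : fieldType) (A B : fdAlg k) (M : bimod A B).

Definition ractr (b : B) : M -> M := fun m => ract m b.

Fact ractr_linear b : linear (ractr b).
Proof. by move=> a m m'; rewrite /ractr ractDl ractZ. Qed.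
HB.instance Definition _ b :=
  GRing.isLinear.Build A M M *:%R (ractr b) (ractr_linear b).

(* M as a right B-module, on a copy of the carrier of the left A-module M. *)
Definition bimodr_car : Type := M.
HB.instance Definition _ := GRing.Zmodule.on bimodr_car.

Let scaler (b : B^c) (m : bimodr_car) : bimodr_car := ract (m : M) (b : B).

Fact bimodr_scaleA a b m : scaler a (scaler b m) = scaler (a * b) m.
Proof. by rewrite /scaler -ractM. Qed.
Fact bimodr_scale1 : left_id 1 scaler.
Proof. exact: ract1. Qed.
Fact bimodr_scaleDr : right_distributive scaler +%R.
Proof. by move=> b m m'; exact: ractDl. Qed.
Fact bimodr_scaleDl m : {morph scaler^~ m : a b / a + b}.
Proof. by move=> b b'; exact: ractDr. Qed.

HB.instance Definition _ := GRing.Zmodule_isLmodule.Build B^c bimodr_car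
  bimodr_scaleA bimodr_scale1 bimodr_scaleDr bimodr_scaleDl.

Definition bimodr : lmodType B^c := bimodr_car.

Definition lactr (a : A) : bimodr -> bimodr := fun m => a *: (m : M).

Fact lactr_linear a : linear (lactr a).
Proof.
move=> b m m'; rewrite /lactr [LHS]scalerDr; congr (_ + _).
exact/esym/ractZ.
Qed.
HB.instance Definition _ a :=
  GRing.isLinear.Build B^c bimodr bimodr *:%R (lactr a) (lactr_linear a).

End BimodRight.

Section TensorFunctor.
Variables (k : fieldType) (A B : fdAlg k) (M : bimod A B).

Section Object.
Variable X : lmodType A^c.

(* X (x)_A M is a right B-module through the right action on M. *)
Definition rtensor_car : Type := tensor X M.
HB.instance Definition _ := GRing.Zmodule.on rtensor_car.

Let scaler (b : B^c) (t : rtensor_car) : rtensor_car :=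
  tens_map (idfun : {linear X -> X}) (ractr b : {linear M -> M}) t.

Fact rtensor_scaleA a b t : scaler a (scaler b t) = scaler (a * b) t.
Proof.
pose m (c : B) : {additive tensor X M -> tensor X M} :=
  tens_map (idfun : {linear X -> X}) (ractr c : {linear M -> M}).
apply: (tens_ext (g := m a \o m b) (h := m (a * b))) => x y /=.
by rewrite !tens_mapE /= /ractr -ractM.
Qed.
Fact rtensor_scale1 : left_id 1 scaler.
Proof.
pose m (c : B) : {additive tensor X M -> tensor X M} :=
  tens_map (idfun : {linear X -> X}) (ractr c : {linear M -> M}).
apply: (tens_ext (g := m 1) (h := idfun)) => x y /=.
by rewrite tens_mapE /= /ractr ract1.
Qed.
Fact rtensor_scaleDr : right_distributive scaler +%R.
Proof. by move=> b t t'; exact: raddfD. Qed.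
Fact rtensor_scaleDl t : {morph scaler^~ t : a b / a + b}.
Proof.
move=> a b.
pose m (c : B) : {additive tensor X M -> tensor X M} :=
  tens_map (idfun : {linear X -> X}) (ractr c : {linear M -> M}).
apply: (tens_ext (g := m (a + b)) (h := m a \+ m b)) => x y /=.
by rewrite !tens_mapE /= /ractr ractDr tensDr.
Qed.

HB.instance Definition _ := GRing.Zmodule_isLmodule.Build B^c rtensor_car
  rtensor_scaleA rtensor_scale1 rtensor_scaleDr rtensor_scaleDl.

Definition rtensor : lmodType B^c := rtensor_car.

Lemma rtensor_scaleE (b : B) x (m : M) :
  (b : B^c) *: (tens x m : rtensor) = tens x (ract m b).
Proof. exact: tens_mapE. Qed.

Lemma rtensor_fin_gen :
  fin_gen X -> fin_gen (bimodr M) -> fin_gen rtensor.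
Proof.
move=> [n [e He]] [p [f Hf]].
pose g (ij : 'I_n * 'I_p) : rtensor := tens (e ij.1) (f ij.2 : M).
pose P (t : rtensor) :=
  exists c : 'I_n * 'I_p -> B^c, t = \sum_ij c ij *: g ij.
apply: (@fin_gen_finType _ _ _ g); rewrite -/P.
have P0 : P 0 by exists (fun=> 0); rewrite big1 // => i _; rewrite scale0r.
have PB (t u : rtensor) : P t -> P u -> P (t - u).
  move=> [c ->] [d ->]; exists (fun ij => c ij - d ij).
  by rewrite -sumrB; apply: eq_bigr => ij _; rewrite scalerBl.
have PD (t u : rtensor) : P t -> P u -> P (t + u).
  by move=> Pt Pu; rewrite -[u]opprK -[- u]sub0r; apply: (PB _ _ Pt); exact: PB.
have Pg (b : B^c) ij : P (b *: g ij).
  exists (fun i => if i == ij then b else 0).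
  rewrite (bigD1 ij) //= eqxx big1 ?addr0 // => i /negPf->.
  by rewrite scale0r.
apply: tens_ind => // x m; have [c ->] := He x.
rewrite tens_suml; apply: (big_ind P) => // i _; rewrite tensA.
have [d Hd] := Hf ((c i : A) *: (m : M)); rewrite [_ *: m]Hd.
rewrite (tens_sumr (Y := M)); apply: (big_ind P) => // j _.
by rewrite -[tens _ _](rtensor_scaleE (d j) (e i) (f j)); exact: (Pg _ (i, j)).
Qed.

End Object.

Definition rtensor_map (X Y : lmodType A^c) (f : {linear X -> Y}) :
  rtensor X -> rtensor Y := tens_map f (idfun : {linear M -> M}).

Fact rtensor_map_linear (X Y : lmodType A^c) (f : {linear X -> Y}) :
  linear (rtensor_map f).
Proof.
pose F : {additive rtensor X -> rtensor Y} :=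
  tens_map f (idfun : {linear M -> M}).
move=> b t u; rewrite -[rtensor_map f]/(F : _ -> _) raddfD; congr (_ + _).
pose mul (Z : lmodType A^c) : {additive rtensor Z -> rtensor Z} := *:%R b.
apply: (tens_ext (g := F \o mul X) (h := mul Y \o F)) => x m /=.
by rewrite rtensor_scaleE !tens_mapE /= rtensor_scaleE.
Qed.
HB.instance Definition _ (X Y : lmodType A^c) (f : {linear X -> Y}) :=
  GRing.isLinear.Build B^c (rtensor X) (rtensor Y) *:%R (rtensor_map f)
    (rtensor_map_linear f).

Hypothesis M_fg : fin_gen (bimodr M).

Definition tensor_ob (X : fgmod A) : fgmod B :=
  FgMod (rtensor_fin_gen (fgmod_fg X) M_fg).

Definition tensor_functor : kfunctor (modcat A) (modcat B).
Proof.
refine (@KFunctor k (modcat A) (modcat B) tensor_ob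
  (fun X Y f => (rtensor_map f : {linear rtensor X -> rtensor Y})) _ _ _ _).
- move=> X; apply: linear_ext => t /=.
  apply: (tens_ext (g := tens_map _ _) (h := idfun)) t => x m /=.
  by rewrite [LHS]tens_mapE.
- move=> X Y Z f g; apply: linear_ext => t /=.
  apply: (tens_ext (g := tens_map _ _)
    (h := tens_map _ _ \o tens_map _ _)) t => x m /=.
  by rewrite !tens_mapE.
- move=> X Y f g; apply: linear_ext => t /=.
  apply: (tens_ext (g := tens_map _ _)
    (h := tens_map _ _ \+ tens_map _ _)) t => x m /=.
  by rewrite !tens_mapE /= tensDl.
- move=> X Y c f; apply: linear_ext => t /=.
  pose mul : {additive rtensor Y -> rtensor Y} := *:%R (scal B c : B^c).
  apply: (tens_ext (g := tens_map _ _)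
    (h := mul \o tens_map _ _)) t => x m /=.
  by rewrite !tens_mapE /= rtensor_scaleE ract_scal /rscale tensA.
Defined.

End TensorFunctor.

Section BimodTensor.
Variables (k : fieldType) (A B C : fdAlg k) (M : bimod A B) (N : bimod B C).

(* M (x)_B N, with A acting on M and C acting on N. *)
Definition btensor_car : Type := tensor (bimodr M) N.
HB.instance Definition _ := GRing.Zmodule.on btensor_car.

Let L (a : A) : {additive btensor_car -> btensor_car} :=
  tens_map (lactr a : {linear bimodr M -> bimodr M}) (idfun : {linear N -> N}).

Let scalel (a : A) (t : btensor_car) : btensor_car := L a t.

Fact btensor_scaleA a b t : scalel a (scalel b t) = scalel (a * b) t.
Proof.
apply: (tens_ext (g := L a \o L b) (h := L (a * b))) => x y /=.
by rewrite !tens_mapE /= /lactr scalerA.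
Qed.
Fact btensor_scale1 : left_id 1 scalel.
Proof.
apply: (tens_ext (g := L 1) (h := idfun)) => x y /=.
by rewrite tens_mapE /= /lactr scale1r.
Qed.
Fact btensor_scaleDr : right_distributive scalel +%R.
Proof. by move=> a t t'; exact: raddfD. Qed.
Fact btensor_scaleDl t : {morph scalel^~ t : a b / a + b}.
Proof.
move=> a b.
apply: (tens_ext (g := L (a + b)) (h := L a \+ L b)) => x y /=.
by rewrite !tens_mapE /= /lactr scalerDl tensDl.
Qed.

HB.instance Definition _ := GRing.Zmodule_isLmodule.Build A btensor_car
  btensor_scaleA btensor_scale1 btensor_scaleDr btensor_scaleDl.

Lemma btensor_scaleE (a : A) (m : M) (n : N) :
  a *: (tens (m : bimodr M) n : btensor_car) = tens (a *: m : bimodr M) n.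
Proof. exact: tens_mapE. Qed.

Definition btensor : bimod A C.
Proof.
refine (@Bimod k A C btensor_car
  (fun t c => ((c : C^c) *: (t : rtensor N (bimodr M))) : btensor_car)
  _ _ _ _ _ _).
- by move=> t t' c; exact: (@scalerDr C^c (rtensor N (bimodr M))).
- by move=> t c c'; exact: (@scalerDl C^c (rtensor N (bimodr M))).
- by move=> t c c'; rewrite (@scalerA C^c (rtensor N (bimodr M))).
- by move=> t; exact: (@scale1r C^c (rtensor N (bimodr M))).
- move=> a t c.
  pose S : {additive rtensor N (bimodr M) -> rtensor N (bimodr M)} :=
    *:%R (c : C^c).
  apply: (tens_ext (g := S \o L a) (h := L a \o S)) t => m n /=.
  by rewrite /= tens_mapE !rtensor_scaleE tens_mapE.
- move=> c t.
  pose S : {additive rtensor N (bimodr M) -> rtensor N (bimodr M)} :=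
    *:%R (scal C c : C^c).
  apply: (tens_ext (g := S) (h := L (scal A c))) t => m n /=.
  rewrite rtensor_scaleE tens_mapE ract_scal -tensA; congr tens.
  exact: (@ract_scal k A B M c m).
Defined.

End BimodTensor.

Section BimodConstructions.
Variables (k : fieldType) (A B : fdAlg k).

Definition regular_bimod : bimod A A.
Proof.
refine (@Bimod k A A (A^o) (fun m a => (m : A) * a) _ _ _ _ _ _).
- by move=> m m' a; exact: mulrDl.
- by move=> m a b; exact: mulrDr.
- by move=> m a b; exact: mulrA.
- by move=> m; exact: mulr1.
- by move=> a m b; exact/esym/mulrA.
- by move=> c m; exact/esym/scalC.
Defined.

Definition bimod_sum (M N : bimod A B) : bimod A B.
Proof.
refine (@Bimod k A B (M * N)%type
  (fun m b => (ract m.1 b, ract m.2 b)) _ _ _ _ _ _).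
- by move=> m m' b; rewrite /= !ractDl.
- by move=> m b b'; rewrite /= !ractDr.
- by move=> m b b'; rewrite /= !ractM.
- by move=> [m n]; rewrite /= !ract1.
- by move=> a [m n] b; rewrite /= !ractZ.
- by move=> c [m n]; rewrite /= !ract_scal.
Defined.

Definition bimod_iso (M N : bimod A B) : Prop :=
  exists f : {linear M -> N},
    (forall m b, f (ract m b) = ract (f m) b) /\ bijective f.

Definition bimod_summand (M N : bimod A B) : Prop :=
  exists X : bimod A B, bimod_iso N (bimod_sum M X).

End BimodConstructions.

(* Mr and Nr are needed to define the tensor functors between the categories of
   finitely generated modules. *)
Definition alg_symm_sep_equiv (k : fieldType) (A B : fdAlg k) : Prop :=
  exists (M : bimod A B) (N : bimod B A)
    (Mr : fin_gen (bimodr M)) (Nr : fin_gen (bimodr N)),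
    [/\ projective (bimodr M) /\ projective (bimodr N),
        (fin_gen M /\ projective M) /\ (fin_gen N /\ projective N),
        bimod_summand (regular_bimod A) (btensor M N),
        bimod_summand (regular_bimod B) (btensor N M) &
        adjoint_pair (tensor_functor Mr) (tensor_functor Nr) /\
        adjoint_pair (tensor_functor Nr) (tensor_functor Mr)].

(* Main.v *)
From HB Require Import structures.
Require Import Defs.
From mathcomp Require Import all_boot all_algebra.

Set Implicit Arguments.
Unset Strict Implicit.
Unset Printing Implicit Defensive.

Import GRing.Theory.
Local Open Scope ring_scope.

(** The theorem reduces to a purely categorical fact once the module categories
    are known to be symmetrically separably equivalent themselves.

    For the module categories, take the tensor functors of the two bimodules M
    and N.  They are adjoint on both sides by hypothesis, so only the splitting
    of the identity is missing: a bimodule splitting of A in M (x) N must be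
    turned into a natural splitting of the identity in - (x) M (x) N
    ([id_summand_tensor]).  The inclusion of A is determined by the image u of
    1, an element of M (x) N on which the two actions of A agree; its
    counterpart on a module X sends x to x (x) u.  The projection h of M (x) N
    onto A gives x (x) m (x) n |-> x h(m (x) n).  The composite is x |-> x h(u),
    and h(u) = 1.

    On the categorical side, let (F, G) be a symmetrical separable equivalence.
    Composition with F and G, on the left or on the right, takes the
    transformations Id => GF and GF => Id (units, counits, inclusions and
    projections alike) to transformations of the same kind between functor
    categories, and the equations they satisfy are checked objectwise.
    Composition on the right reverses the order of F and G and so swaps left and
    right adjoints, which is harmless as both adjunctions are assumed.  This
    gives [cat_symm_sep_equiv_postcomp] and [cat_symm_sep_equiv_precomp], hence
    (c) and (b).  For (a), go from Fun(mod A, mod C) to Fun(mod B, mod C) and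
    then to Fun(mod B, mod D), by transitivity
    ([cat_symm_sep_equiv_trans]). *)

(** * Functor categories *)

Section FunctorInduced.
Variable k : fieldType.
Implicit Types C D E : kcat k.

Definition postcomp C D E (F : kfunctor C D) : kfunctor (Fun E C) (Fun E D).
Proof.
unshelve refine (@KFunctor k (Fun E C) (Fun E D) (fun H => kfunctor_comp F H)
  (fun H K s => @NatTrans k E D (kfunctor_comp F H) (kfunctor_comp F K)
     (fun x => fmap F (s x)) _) _ _ _ _).
- by move=> x y f /=; rewrite -!fmap_comp naturality.
- by move=> H; apply: nattrans_ext => x /=; rewrite fmap1.
- by move=> H K L s t; apply: nattrans_ext => x /=; rewrite fmap_comp.
- by move=> H K s t; apply: nattrans_ext => x /=; rewrite fmapD.
- by move=> H K a s; apply: nattrans_ext => x /=; rewrite fmapZ.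
Defined.

Definition precomp C D E (F : kfunctor C D) : kfunctor (Fun D E) (Fun C E).
Proof.
unshelve refine (@KFunctor k (Fun D E) (Fun C E) (fun H => kfunctor_comp H F)
  (fun H K s => @NatTrans k C E (kfunctor_comp H F) (kfunctor_comp K F)
     (fun x => s (F x)) _) _ _ _ _).
- by move=> x y f /=; rewrite naturality.
- by move=> H; apply: nattrans_ext.
- by move=> H K L s t; apply: nattrans_ext.
- by move=> H K s t; apply: nattrans_ext.
- by move=> H K a s; apply: nattrans_ext.
Defined.

(** A transformation between the identity and GF induces one between the
    identity and the functor that composes with F and then with G.  As H and Id o H (or
    (GF)H and G(FH)) are different functors with the same values, these
    transformations are built from their components instead of by whiskering. *)
Section Whiskering.
Variables (C D E : kcat k) (F : kfunctor C D) (G : kfunctor D C).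

Definition postcomp_in (i : nattrans (kfunctor_id C) (kfunctor_comp G F)) :
  nattrans (kfunctor_id (Fun E C))
    (kfunctor_comp (postcomp E G) (postcomp E F)).
Proof.
unshelve refine (@NatTrans k (Fun E C) (Fun E C) (kfunctor_id _)
  (kfunctor_comp (postcomp E G) (postcomp E F))
  (fun H => @NatTrans k E C H (kfunctor_comp G (kfunctor_comp F H))
     (fun x => i (H x)) _) _).
- by move=> x y f; exact: (naturality i).
- by move=> H K s; apply: nattrans_ext => x; exact: (naturality i).
Defined.

Definition postcomp_out (p : nattrans (kfunctor_comp G F) (kfunctor_id C)) :
  nattrans (kfunctor_comp (postcomp E G) (postcomp E F))
    (kfunctor_id (Fun E C)).
Proof.
unshelve refine (@NatTrans k (Fun E C) (Fun E C)
  (kfunctor_comp (postcomp E G) (postcomp E F)) (kfunctor_id _)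
  (fun H => @NatTrans k E C (kfunctor_comp G (kfunctor_comp F H)) H
     (fun x => p (H x)) _) _).
- by move=> x y f; exact: (naturality p).
- by move=> H K s; apply: nattrans_ext => x; exact: (naturality p).
Defined.

(** Precomposition is contravariant in the composed functor, so that GF
    corresponds to precomposing with G first and with F afterwards. *)
Definition precomp_in (i : nattrans (kfunctor_id C) (kfunctor_comp G F)) :
  nattrans (kfunctor_id (Fun C E)) (kfunctor_comp (precomp E F) (precomp E G)).
Proof.
unshelve refine (@NatTrans k (Fun C E) (Fun C E) (kfunctor_id _)
  (kfunctor_comp (precomp E F) (precomp E G))
  (fun H => @NatTrans k C E H (kfunctor_comp (kfunctor_comp H G) F)
     (fun x => fmap H (i x)) _) _).
- move=> x y f; rewrite /= -!fmap_comp; congr fmap; exact: (naturality i).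
- by move=> H K s; apply: nattrans_ext => x /=; rewrite naturality.
Defined.

Definition precomp_out (p : nattrans (kfunctor_comp G F) (kfunctor_id C)) :
  nattrans (kfunctor_comp (precomp E F) (precomp E G)) (kfunctor_id (Fun C E)).
Proof.
unshelve refine (@NatTrans k (Fun C E) (Fun C E)
  (kfunctor_comp (precomp E F) (precomp E G)) (kfunctor_id _)
  (fun H => @NatTrans k C E (kfunctor_comp (kfunctor_comp H G) F) H
     (fun x => fmap H (p x)) _) _).
- move=> x y f; rewrite /= -!fmap_comp; congr fmap; exact: (naturality p).
- by move=> H K s; apply: nattrans_ext => x /=; rewrite naturality.
Defined.

End Whiskering.

Section CompositeTransformations.
Variables (C D E : kcat k) (F : kfunctor C D) (G : kfunctor D C).
Variables (F' : kfunctor D E) (G' : kfunctor E D).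

Definition comp_in (i : nattrans (kfunctor_id C) (kfunctor_comp G F))
    (i' : nattrans (kfunctor_id D) (kfunctor_comp G' F')) :
  nattrans (kfunctor_id C)
    (kfunctor_comp (kfunctor_comp G G') (kfunctor_comp F' F)).
Proof.
unshelve refine (@NatTrans k C C (kfunctor_id C)
  (kfunctor_comp (kfunctor_comp G G') (kfunctor_comp F' F))
  (fun x => kcomp (fmap G (i' (F x))) (i x)) _).
move=> x y f; rewrite /= -Defs.compA [kcomp (i y) _](naturality i).
rewrite !Defs.compA -!fmap_comp.
by congr kcomp; rewrite /= -fmap_comp; congr fmap; exact: (naturality i').
Defined.

Definition comp_out (p : nattrans (kfunctor_comp G F) (kfunctor_id C))
    (p' : nattrans (kfunctor_comp G' F') (kfunctor_id D)) :
  nattrans (kfunctor_comp (kfunctor_comp G G') (kfunctor_comp F' F))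
    (kfunctor_id C).
Proof.
unshelve refine (@NatTrans k C C
  (kfunctor_comp (kfunctor_comp G G') (kfunctor_comp F' F)) (kfunctor_id C)
  (fun x => kcomp (p x) (fmap G (p' (F x)))) _).
move=> x y f; rewrite /= -Defs.compA -fmap_comp.
rewrite [kcomp (p' _) _](naturality p') fmap_comp.
by rewrite !Defs.compA; congr kcomp; exact: (naturality p).
Defined.

End CompositeTransformations.

(** A composite of transformations is the identity as soon as it is so at every
    object, because naturality proofs are irrelevant. *)
Lemma id_summandP C (H : kfunctor C C) : id_summand H <->
  exists (i : nattrans (kfunctor_id C) H) (p : nattrans H (kfunctor_id C)),
    forall x, kcomp (p x) (i x) = kidm x.
Proof.
split=> -[i [p pi]]; exists i, p; last exact: nattrans_ext.
by move=> x; rewrite -[kcomp _ _]/(nvcomp p i x) pi.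
Qed.

Lemma adjoint_postcomp C D E (F : kfunctor C D) (G : kfunctor D C) :
  adjoint_pair F G -> adjoint_pair (postcomp E F) (postcomp E G).
Proof.
move=> [eta [eps [triF triG]]].
exists (postcomp_in E eta), (postcomp_out E eps).
by split=> H; apply: nattrans_ext => x; [exact: triF | exact: triG].
Qed.

(** Precomposition reverses composition, so the precomposition with the right
    adjoint G becomes the left adjoint; the unit and counit at H are H(eta) and
    H(eps), and each triangle identity is H applied to the other one. *)
Lemma adjoint_precomp C D E (F : kfunctor C D) (G : kfunctor D C) :
  adjoint_pair F G -> adjoint_pair (precomp E G) (precomp E F).
Proof.
move=> [eta [eps [triF triG]]].
exists (precomp_in E eta), (precomp_out E eps).
split=> H; apply: nattrans_ext => x /=; rewrite -fmap_comp -fmap1.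
- by rewrite triG.
- by rewrite triF.
Qed.

Lemma adjoint_comp C D E (F : kfunctor C D) (G : kfunctor D C)
    (F' : kfunctor D E) (G' : kfunctor E D) :
  adjoint_pair F G -> adjoint_pair F' G' ->
  adjoint_pair (kfunctor_comp F' F) (kfunctor_comp G G').
Proof.
move=> [eta [eps [triF triG]]] [eta' [eps' [triF' triG']]].
exists (comp_in eta eta'), (comp_out eps' eps).
split=> [x|z] /=.
(* naturality of eps at eta' turns eps . FG(eta') . F(eta) into
   eta' . eps . F(eta), where the first triangle identity applies *)
- rewrite -Defs.compA -fmap_comp [fmap F (kcomp _ _)]fmap_comp.
  rewrite [X in fmap F' X]Defs.compA.
  rewrite [kcomp (eps _) _](naturality eps (eta' (F x))) -Defs.compA triF.
  by rewrite compm1; exact: triF'.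
(* dually, by naturality of eta' at eps *)
- rewrite Defs.compA -fmap_comp [fmap G' (kcomp _ _)]fmap_comp.
  rewrite -[X in fmap G X]Defs.compA.
  rewrite -[kcomp (fmap G' _) (eta' _)](naturality eta' (eps (G' z))).
  by rewrite Defs.compA triG' comp1m; exact: triG.
Qed.

Lemma id_summand_postcomp C D E (F : kfunctor C D) (G : kfunctor D C) :
  id_summand (kfunctor_comp G F) ->
  id_summand (kfunctor_comp (postcomp E G) (postcomp E F)).
Proof.
move=> /id_summandP[i [p pi]]; apply/id_summandP.
exists (postcomp_in E i), (postcomp_out E p) => H.
by apply: nattrans_ext => x; exact: pi.
Qed.

Lemma id_summand_precomp C D E (F : kfunctor C D) (G : kfunctor D C) :
  id_summand (kfunctor_comp G F) ->
  id_summand (kfunctor_comp (precomp E F) (precomp E G)).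
Proof.
move=> /id_summandP[i [p pi]]; apply/id_summandP.
exists (precomp_in E i), (precomp_out E p) => H.
by apply: nattrans_ext => x /=; rewrite -fmap_comp pi fmap1.
Qed.

Lemma id_summand_comp C D E (F : kfunctor C D) (G : kfunctor D C)
    (F' : kfunctor D E) (G' : kfunctor E D) :
  id_summand (kfunctor_comp G F) -> id_summand (kfunctor_comp G' F') ->
  id_summand (kfunctor_comp (kfunctor_comp G G') (kfunctor_comp F' F)).
Proof.
move=> /id_summandP[i [p pi]] /id_summandP[i' [p' pi']]; apply/id_summandP.
exists (comp_in i i'), (comp_out p p') => x /=.
rewrite -Defs.compA [X in kcomp _ X]Defs.compA -fmap_comp pi' fmap1.
by rewrite comp1m pi.
Qed.

Lemma cat_symm_sep_equiv_postcomp C D E :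
  cat_symm_sep_equiv C D -> cat_symm_sep_equiv (Fun E C) (Fun E D).
Proof.
move=> [F [G [FG GF iGF iFG]]]; exists (postcomp E F), (postcomp E G).
by split; [exact: adjoint_postcomp.. | exact: id_summand_postcomp
  | exact: id_summand_postcomp].
Qed.

(** The functor Fun(C, E) -> Fun(D, E) is the precomposition with G : D -> C. *)
Lemma cat_symm_sep_equiv_precomp C D E :
  cat_symm_sep_equiv C D -> cat_symm_sep_equiv (Fun C E) (Fun D E).
Proof.
move=> [F [G [FG GF iGF iFG]]]; exists (precomp E G), (precomp E F).
by split; [exact: adjoint_precomp.. | exact: id_summand_precomp
  | exact: id_summand_precomp].
Qed.

Lemma cat_symm_sep_equiv_trans C D E :
  cat_symm_sep_equiv C D -> cat_symm_sep_equiv D E -> cat_symm_sep_equiv C E.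
Proof.
move=> [F [G [FG GF iGF iFG]]] [F' [G' [FG' GF' iGF' iFG']]].
exists (kfunctor_comp F' F), (kfunctor_comp G G').
by split; [exact: adjoint_comp | exact: adjoint_comp
  | exact: id_summand_comp | exact: id_summand_comp].
Qed.

End FunctorInduced.

(** * Tensor functors *)

Lemma rtensor_mapE (k : fieldType) (A B : fdAlg k) (M : bimod A B)
    (X Y : lmodType A^c) (f : {linear X -> Y}) x (m : M) :
  rtensor_map (M := M) f (tens x m) = tens (f x) m.
Proof. exact: tens_mapE. Qed.

Section BimoduleTransformations.
Variables (k : fieldType) (A B : fdAlg k) (M : bimod A B) (N : bimod B A).

Local Notation MN := (btensor M N).

(** The map t |-> x (x) t from M (x)_B N to (X (x)_A M) (x)_B N, where the
    associativity of the tensor product is implicit. *)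
Section Insertion.
Variables (X : lmodType A^c) (x : X).

Definition tensl (m : bimodr M) : rtensor M X := tens x (m : M).

Fact tensl_linear : linear tensl.
Proof.
move=> b m m'; rewrite /tensl [LHS](tensDr (Y := M)) rtensor_scaleE.
exact: erefl.
Qed.
HB.instance Definition _ :=
  GRing.isLinear.Build B^c (bimodr M) (rtensor M X) *:%R tensl tensl_linear.

Definition insert : {additive MN -> rtensor N (rtensor M X)} :=
  tens_map (tensl : {linear bimodr M -> rtensor M X})
    (idfun : {linear N -> N}).

Lemma insertE (m : M) (n : N) :
  insert (tens (m : bimodr M) n) = tens (tens x m : rtensor M X) n.
Proof. exact: tens_mapE. Qed.

(** The right action of A comes from N, which tensoring with x does not touch. *)
Lemma insert_ract (u : MN) (a : A) :
  insert (ract u a) = (a : A^c) *: insert u.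
Proof.
pose r : {additive rtensor N (bimodr M) -> rtensor N (bimodr M)} :=
  *:%R (a : A^c).
(* the source is written as a right A-module so that i \o r typechecks *)
pose i : {additive rtensor N (bimodr M) -> rtensor N (rtensor M X)} :=
  tens_map (tensl : {linear bimodr M -> rtensor M X})
    (idfun : {linear N -> N}).
pose s : {additive rtensor N (rtensor M X) -> rtensor N (rtensor M X)} :=
  *:%R (a : A^c).
apply: (tens_ext (g := i \o r) (h := s \o insert)) u => m n /=.
by rewrite /i insertE !rtensor_scaleE tens_mapE.
Qed.

End Insertion.

Lemma insertD (X : lmodType A^c) (x y : X) (u : MN) :
  insert (x + y) u = insert x u + insert y u.
Proof.
apply: (tens_ext (g := insert (x + y)) (h := insert x \+ insert y)) u => m n.
by rewrite /= !insertE -tensDl -tensDl.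
Qed.

Lemma insertZ (X : lmodType A^c) (a : A) (x : X) (u : MN) :
  insert ((a : A^c) *: x) u = insert x (a *: u).
Proof.
pose l : {additive MN -> MN} := *:%R a.
apply: (tens_ext (g := insert ((a : A^c) *: x)) (h := insert x \o l)) u => m n.
by rewrite /= insertE btensor_scaleE insertE tensA.
Qed.

Lemma insert_natural (X Y : lmodType A^c) (f : {linear X -> Y}) x (u : MN) :
  rtensor_map (M := N) (rtensor_map (M := M) f) (insert x u) = insert (f x) u.
Proof.
pose g : {additive rtensor N (rtensor M X) -> rtensor N (rtensor M Y)} :=
  rtensor_map (M := N) (rtensor_map (M := M) f).
apply: (tens_ext (g := g \o insert x) (h := insert (f x))) u => m n.
by rewrite /= !insertE /g /= rtensor_mapE /= rtensor_mapE.
Qed.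

(** The elements (x (x) m) (x) n span the iterated tensor product. *)
Lemma rtensor2_ext (X : lmodType A^c) (Z : zmodType)
    (f g : {additive rtensor N (rtensor M X) -> Z}) :
  (forall x (m : M) n, f (tens (tens x m : rtensor M X) n)
    = g (tens (tens x m : rtensor M X) n)) -> f =1 g.
Proof.
move=> fg; apply: tens_ext => t n; move: t.
pose at_n (w : {additive rtensor N (rtensor M X) -> Z}) (t : rtensor M X) :=
  w (tens t n).
have at_nB w : zmod_morphism (at_n w).
  move=> t u; rewrite /at_n -raddfB; congr (w _); apply/eqP.
  by rewrite eq_sym subr_eq -tensDl subrK.
pose at_n_add w : {additive rtensor M X -> Z} :=
  HB.pack (at_n w) (GRing.isZmodMorphism.Build _ _ _ (at_nB w)).
apply: (tens_ext (g := at_n_add f) (h := at_n_add g)) => x m; exact: fg.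
Qed.

(** The map (x (x) m) (x) n |-> x h(m (x) n).  It is obtained by two successive
    liftings, in t = x (x) m with n fixed ([contract_at]) and then in (t, n). *)
Section Contraction.
Variable h : {linear MN -> regular_bimod A}.
Hypothesis h_ract : forall u a, h (ract u a) = ract (h u) a.

Let hA (u : MN) : A := h u.

Section Object.
Variable X : lmodType A^c.

Let c1 n x (m : M) : X := (hA (tens (m : bimodr M) n) : A^c) *: x.

Definition contract_at (n : N) (t : rtensor M X) : X := tens_lift (c1 n) t.

Let cDl1 n x x' m : c1 n (x + x') m = c1 n x m + c1 n x' m.
Proof. exact: scalerDr. Qed.

Let cDr1 n x m m' : c1 n x (m + m') = c1 n x m + c1 n x m'.
Proof. by rewrite /c1 /hA (tensDl (X := bimodr M)) raddfD /= -scalerDl. Qed.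

Let cA1 n x (a : A) m : c1 n ((a : A^c) *: x) m = c1 n x (a *: m).
Proof. by rewrite /c1 /hA -btensor_scaleE linearZ scalerA. Qed.

Lemma contract_atE n x (m : M) :
  contract_at n (tens x m) = (hA (tens (m : bimodr M) n) : A^c) *: x.
Proof. exact: (tens_liftE (cDl1 n) (cDr1 n) (cA1 n)). Qed.

Fact contract_at_zmod n : zmod_morphism (contract_at n).
Proof. exact: (tens_liftB (cDl1 n) (cDr1 n) (cA1 n)). Qed.
HB.instance Definition _ n :=
  GRing.isZmodMorphism.Build (rtensor M X) X (contract_at n)
    (contract_at_zmod n).

Let c2 t n := contract_at n t.

Let cDl2 t t' n : c2 (t + t') n = c2 t n + c2 t' n.
Proof. exact: raddfD. Qed.

Let cDr2 t n n' : c2 t (n + n') = c2 t n + c2 t n'.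
Proof.
apply: (tens_ext (g := contract_at (n + n'))
  (h := contract_at n \+ contract_at n')) t => x m.
by rewrite /= !contract_atE /hA tensDr raddfD -scalerDl.
Qed.

Let cA2 (t : rtensor M X) (b : B) n : c2 ((b : B^c) *: t) n = c2 t (b *: n).
Proof.
pose s : {additive rtensor M X -> rtensor M X} := *:%R (b : B^c).
apply: (tens_ext (g := contract_at n \o s)
  (h := contract_at (b *: n))) t => x m.
by rewrite /= rtensor_scaleE !contract_atE /hA -tensA.
Qed.

Definition contract (t : rtensor N (rtensor M X)) : X := tens_lift c2 t.

Lemma contractE x (m : M) n :
  contract (tens (tens x m : rtensor M X) n) =
    (hA (tens (m : bimodr M) n) : A^c) *: x.
Proof. by rewrite /contract (tens_liftE cDl2 cDr2 cA2) /c2 contract_atE. Qed.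

Fact contract_zmod : zmod_morphism contract.
Proof. exact: (tens_liftB cDl2 cDr2 cA2). Qed.
HB.instance Definition _ :=
  GRing.isZmodMorphism.Build (rtensor N (rtensor M X)) X contract contract_zmod.

End Object.

Fact contract_linear (X : lmodType A^c) : linear (@contract X).
Proof.
move=> a t u; rewrite raddfD; congr (_ + _).
pose s : {additive rtensor N (rtensor M X) -> rtensor N (rtensor M X)} :=
  *:%R (a : A^c).
pose s' : {additive X -> X} := *:%R (a : A^c).
apply: (rtensor2_ext (f := @contract X \o s)
  (g := s' \o @contract X)) t => x m n.
rewrite /= rtensor_scaleE !contractE /s' scalerA.
rewrite /hA -[tens _ _](rtensor_scaleE (M := N) a (m : bimodr M) n).
by congr (_ *: _); exact: h_ract.
Qed.
HB.instance Definition _ X :=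
  GRing.isLinear.Build A^c (rtensor N (rtensor M X)) X *:%R (@contract X)
    (@contract_linear X).

Definition contract_hom (X : lmodType A^c) :
  {linear rtensor N (rtensor M X) -> X} := @contract X.

Lemma contract_natural (X Y : lmodType A^c) (f : {linear X -> Y}) t :
  contract (rtensor_map (M := N) (rtensor_map (M := M) f) t) = f (contract t).
Proof.
pose g : {additive rtensor N (rtensor M X) -> rtensor N (rtensor M Y)} :=
  rtensor_map (M := N) (rtensor_map (M := M) f).
apply: (rtensor2_ext (f := @contract Y \o g)
  (g := f \o @contract X)) t => x m n.
by rewrite /g /= rtensor_mapE /= rtensor_mapE !contractE linearZ.
Qed.

Lemma contract_insert (X : lmodType A^c) (x : X) (u : MN) :
  contract (insert x u) = (hA u : A^c) *: x.
Proof.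
pose scalex (v : MN) : X := (hA v : A^c) *: x.
have scalexB : zmod_morphism scalex.
  by move=> v w; rewrite /scalex /hA raddfB -scalerBl.
pose g : {additive MN -> X} :=
  HB.pack scalex (GRing.isZmodMorphism.Build _ _ _ scalexB).
apply: (tens_ext (g := @contract X \o insert x) (h := g)) u => m n.
by rewrite /= insertE contractE.
Qed.

End Contraction.

(** The map x |-> x (x) u is A-linear because u commutes with A:
    (x a) (x) u = x (x) (a u) = x (x) (u a). *)
Section Central.
Variable u : MN.
Hypothesis u_central : forall a : A, a *: u = ract u a.

Definition insert_elt (X : lmodType A^c) (x : X) : rtensor N (rtensor M X) :=
  insert x u.

Fact insert_elt_linear X : linear (@insert_elt X).
Proof.
by move=> a x y; rewrite /insert_elt insertD insertZ u_central insert_ract.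
Qed.
HB.instance Definition _ X :=
  GRing.isLinear.Build A^c X (rtensor N (rtensor M X)) *:%R (@insert_elt X)
    (@insert_elt_linear X).

Definition insert_hom (X : lmodType A^c) :
  {linear X -> rtensor N (rtensor M X)} := @insert_elt X.

End Central.

(** A splitting A -> M (x) N -> A of bimodules splits the identity functor: u is
    the image of 1 under the inclusion, and h is the projection. *)
Lemma id_summand_tensor (Mr : fin_gen (bimodr M)) (Nr : fin_gen (bimodr N)) :
  bimod_summand (regular_bimod A) MN ->
  id_summand (kfunctor_comp (tensor_functor Nr) (tensor_functor Mr)).
Proof.
move=> [S [f [f_ract [g gK fK]]]].
(* g is only an inverse of f, so its linearity is avoided: centrality of u is
   checked after applying f *)
pose u : MN := g (1 : A, 0).
have u_central (a : A) : a *: u = ract u a.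
  apply: (can_inj gK); rewrite linearZ f_ract /u fK.
  apply: injective_projections => /=; first by rewrite mul1r; exact: mulr1.
  by rewrite -[X in ract X](scale0r (0 : S)) ractZ scale0r scaler0.
pose h (t : MN) : regular_bimod A := (f t).1.
have h_lin : linear h by move=> a s t; rewrite /h linearP.
pose hl : {linear MN -> regular_bimod A} :=
  HB.pack h (GRing.isLinear.Build _ _ _ _ _ h_lin).
have h_ract s a : hl (ract s a) = ract (hl s) a.
  by rewrite /= /h f_ract.
apply/id_summandP.
unshelve eexists.
  refine (@NatTrans k (modcat A) (modcat A) (kfunctor_id _)
    (kfunctor_comp (tensor_functor Nr) (tensor_functor Mr))
    (fun X => insert_hom u_central X) _).
  by move=> X Y q; apply: linear_ext => x; exact/esym/insert_natural.
unshelve eexists.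
  refine (@NatTrans k (modcat A) (modcat A)
    (kfunctor_comp (tensor_functor Nr) (tensor_functor Mr)) (kfunctor_id _)
    (fun X => contract_hom h_ract X) _).
  by move=> X Y q; apply: linear_ext => x; exact: contract_natural.
move=> X; apply: linear_ext => x.
by rewrite /= [LHS]contract_insert /= /h /u fK; exact: scale1r.
Qed.

End BimoduleTransformations.

Lemma alg_to_cat_symm_sep_equiv (k : fieldType) (A B : fdAlg k) :
  alg_symm_sep_equiv A B -> cat_symm_sep_equiv (modcat A) (modcat B).
Proof.
move=> [M [N [Mr [Nr [_ _ sumA sumB [MN_adj NM_adj]]]]]].
exists (tensor_functor Mr), (tensor_functor Nr).
by split=> //; exact: id_summand_tensor.
Qed.

Theorem theorem2 (k : fieldType) (A B C D : fdAlg k)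
    (hAB : alg_symm_sep_equiv A B) (hCD : alg_symm_sep_equiv C D)
    (E : kcat k) :
  [/\ cat_symm_sep_equiv (Fun (modcat A) (modcat C)) (Fun (modcat B) (modcat D)),
      cat_symm_sep_equiv (Fun (modcat A) E) (Fun (modcat B) E) &
      cat_symm_sep_equiv (Fun E (modcat A)) (Fun E (modcat B))].
Proof.
have AB := alg_to_cat_symm_sep_equiv hAB.
have CD := alg_to_cat_symm_sep_equiv hCD.
split.
- apply: (@cat_symm_sep_equiv_trans k _ (Fun (modcat B) (modcat C))).
    exact: cat_symm_sep_equiv_precomp.
  exact: cat_symm_sep_equiv_postcomp.
- exact: cat_symm_sep_equiv_precomp.
- exact: cat_symm_sep_equiv_postcomp.
Qed.
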